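(* Let $F\in\mathcal{H}^d$ with homogeneity matrix $A$ and let $\mathbf{b}\in\mathbb{R}^d_{++}$ with $\sum_{i=1}^d b_i=1$. Suppose that $F$ has a positive eigenvector $\mathbf{u}\in\mathbb{S}_{++}$. (1) The vector $\mathbf{u}$ is the unique eigenvector of $F$ in $\mathbb{S}_{++}$ if either (a) $\rho(A)<1$, or (b) $A^\top\mathbf{b}=\mathbf{b}$, $F$ is differentiable at $\mathbf{u}$ and $DF(\mathbf{u})$ is irreducible. (2) Suppose furthermore that $F$ has an eigenvector $\mathbf{v}\in\mathbb{S}_+\setminus\mathbb{S}_{++}$ and let $\boldsymbol{\theta}\in\mathbb{R}^d_+$ be such that $F(\mathbf{v})=\boldsymbol{\theta}\otimes\mathbf{v}$. If $A^\top\mathbf{b}=\rho(A)\mathbf{b}$, $F$ is differentiable at $\mathbf{u}$ and $DF(\mathbf{u})$ is irreducible, then $\prod_{i=1}^d\theta_i^{b_i}<r_{\mathbf{b}}(F)$.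
   Context: Fix positive integers $d,n_1,\dots,n_d$ and write $[n]=\{1,\dots,n\}$. Let $V=\mathbb{R}^{n_1}\times\cdots\times\mathbb{R}^{n_d}$, $\mathcal{K}_+=\mathbb{R}^{n_1}_+\times\cdots\times\mathbb{R}^{n_d}_+$ (vectors with nonnegative entries), and let $\mathcal{K}_{++}$ be its interior (all entries positive). Elements are written $\mathbf{x}=(\mathbf{x}_1,\dots,\mathbf{x}_d)$ with $\mathbf{x}_i\in\mathbb{R}^{n_i}$. Write $\mathbf{x}\le_{\mathcal{K}}\mathbf{y}$ if $\mathbf{y}-\mathbf{x}\in\mathcal{K}_+$. For $\boldsymbol{\alpha}\in\mathbb{R}^d$, $\mathbf{x}\in V$ set $\boldsymbol{\alpha}\otimes\mathbf{x}=(\alpha_1\mathbf{x}_1,\dots,\alpha_d\mathbf{x}_d)$. For $\boldsymbol{\alpha}\in\mathbb{R}^d_+$ and a nonnegative $d\times d$ matrix $A$ set $\boldsymbol{\alpha}^A=(\prod_k\alpha_k^{A_{1,k}},\dots,\prod_k\alpha_k^{A_{d,k}})$ (with $0^0=1$); $\rho(A)$ is the spectral radius of $A$. $\mathcal{H}^d$ is the set of continuous maps $F=(F_1,\dots,F_d):\mathcal{K}_+\to\mathcal{K}_+$ such that: (i) there is a nonnegative $d\times d$ matrix $A$ (the homogeneity matrix of $F$) with $F(\boldsymbol{\alpha}\otimes\mathbf{x})=\boldsymbol{\alpha}^A\otimes F(\mathbf{x})$ for all $\boldsymbol{\alpha}\in\mathbb{R}^d_+$, $\mathbf{x}\in\mathcal{K}_+$;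 (ii) $F$ is order-preserving: $\mathbf{x}\le_{\mathcal{K}}\mathbf{y}$ implies $F(\mathbf{x})\le_{\mathcal{K}}F(\mathbf{y})$; (iii) $F$ is nondegenerate: $F(\mathcal{K}_{++})\subset\mathcal{K}_{++}$ and $A\mathbb{R}^d_{++}\subset\mathbb{R}^d_{++}$. An eigenvector of $F\in\mathcal{H}^d$ is $\mathbf{x}\in\mathcal{K}_+$ with $\mathbf{x}_i\ne0$ for every $i\in[d]$ and $F(\mathbf{x})=\boldsymbol{\lambda}\otimes\mathbf{x}$ for some $\boldsymbol{\lambda}\in\mathbb{R}^d_+$; it is positive if $\mathbf{x}\in\mathcal{K}_{++}$. $DF(\mathbf{u})$ is the Jacobian matrix of $F$ at $\mathbf{u}$, a square matrix of size $n_1+\dots+n_d$ (it is entrywise nonnegative because $F$ is order-preserving). Each $\mathbb{R}^{n_i}$ carries a fixed norm $\|\cdot\|_{\gamma_i}$ that is monotonic ($|\mathbf{x}_i|\le|\mathbf{y}_i|$ entrywise implies $\|\mathbf{x}_i\|_{\gamma_i}\le\|\mathbf{y}_i\|_{\gamma_i}$). $\mathbb{S}_+=\{\mathbf{x}\in\mathcal{K}_+:\|\mathbf{x}_i\|_{\gamma_i}=1\ \forall i\in[d]\}$ and $\mathbb{S}_{++}=\mathbb{S}_+\cap\mathcal{K}_{++}$. The spectral radius is $$r_{\mathbf{b}}(F)=\sup\Big\{\prod_{i=1}^d\lambda_i^{b_i}\ :\ F(\mathbf{x})=\boldsymbol{\lambda}\otimes\mathbf{x}\text{ for some }\mathbf{x}\in\mathbb{S}_+,\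 \boldsymbol{\lambda}\in\mathbb{R}^d_+\Big\}.$$
   Formalization: Part (2) is proved under the additional assumption ρ(A) ≤ 1; without it the claim fails, e.g. for d=1, F(x,y)=(x²+cxy, y²+cxy) with 0<c<1, where v=(1,0) attains r_b(F)=1. *)

(* Defs.v *)
From HB Require Import structures.
From mathcomp Require Import all_boot all_order all_algebra.
From mathcomp Require Import complex.
From mathcomp Require Import all_classical all_reals all_analysis.

Set Implicit Arguments.
Unset Strict Implicit.
Unset Printing Implicit Defensive.

Import Order.TTheory GRing.Theory Num.Theory.
Import numFieldNormedType.Exports.

Local Open Scope classical_set_scope.
Local Open Scope ring_scope.

(* The product R^{n_1} x ... x R^{n_d} is stored as one row vector of length
   \sum_i n i; the block x_i is [submxrow x i], and \mxrow_i rebuilds a vector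
   from its blocks.  In this form it is a normed module, so that the library's
   [continuous], [differentiable] and [jacobian] apply.  Elements of R^d are
   column vectors. *)
Notation multivec R n := 'rV[R]_(\sum_i n i).

Section MultiHomogeneous.
Variable R : realType.

Definition mx_nonneg m p (M : 'M[R]_(m, p)) : Prop := forall i j, 0 <= M i j.

Definition mx_pos m p (M : 'M[R]_(m, p)) : Prop := forall i j, 0 < M i j.

Definition spectral_radius m (M : 'M[R]_m) : R :=
  sup [set ComplexField.Normc.normc z
      | z in [set z : R[i] | eigenvalue (map_mx (real_complex R) M) z]].

(* M is reducible when, after a simultaneous permutation of rows and columns,
   it is block triangular with two nonempty diagonal blocks, i.e. when some
   proper nonempty S has M_{ij} = 0 for all i in S and j not in S.  A 1 x 1
   matrix is irreducible. *)
Definition irreducible_mx m (M : 'M[R]_m) : Prop :=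
  ~ exists S : {set 'I_m},
      [/\ S != finset.set0, S != finset.setT
        & forall i j, i \in S -> j \notin S -> M i j = 0].

(* A norm on R^m, monotonic with respect to entrywise absolute values. *)
Definition monotonic_norm m (N : 'rV[R]_m -> R) : Prop :=
  [/\ forall x, N x = 0 -> x = 0,
      forall (a : R) x, N (a *: x) = `|a| * N x,
      forall x y, N (x + y) <= N x + N y
    & forall x y : 'rV[R]_m, (forall j, `|x 0 j| <= `|y 0 j|) -> N x <= N y].

Variables (d : nat) (n : 'I_d -> nat).
Implicit Types (x y : multivec R n) (a l b : 'cV[R]_d) (A : 'M[R]_d).
Implicit Type F : multivec R n -> multivec R n.
Implicit Type g : forall i, 'rV[R]_(n i) -> R.

Definition Kplus : set (multivec R n) := [set x | mx_nonneg x].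

Definition Kpplus : set (multivec R n) := [set x | mx_pos x].

Definition leK x y : Prop := Kplus (y - x).

Definition otimes a x : multivec R n := \mxrow_i (a i 0 *: submxrow x i).

(* For a nonnegative base, [powR] satisfies 0 `^ 0 = 1 and 0 `^ p = 0 for
   p != 0. *)
Definition mpow a A : 'cV[R]_d := \col_i \prod_k (a k 0 `^ A i k).

Definition wprod b l : R := \prod_i (l i 0 `^ b i 0).

(* F is a total function on the ambient space, but only its restriction to
   Kplus is constrained. *)
Definition in_Hd F A : Prop :=
  [/\ forall x, Kplus x -> Kplus (F x),
      {within Kplus, continuous F},
      mx_nonneg A /\
      (forall a x, mx_nonneg a -> Kplus x ->
        F (otimes a x) = otimes (mpow a A) (F x)),
      forall x y, Kplus x -> Kplus y -> leK x y -> leK (F x) (F y)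
    & (forall x, Kpplus x -> Kpplus (F x)) /\
      (forall w : 'cV[R]_d, mx_pos w -> mx_pos (A *m w))].

Definition eigenvector F x : Prop :=
  [/\ Kplus x, forall i, submxrow x i != 0
    & exists l, mx_nonneg l /\ F x = otimes l x].

Definition Splus g : set (multivec R n) :=
  [set x | Kplus x /\ forall i, g i (submxrow x i) = 1].

Definition Spplus g : set (multivec R n) := Splus g `&` Kpplus.

Definition rspec g b F : R :=
  sup [set r | exists x l,
         [/\ Splus g x, mx_nonneg l, F x = otimes l x & r = wprod b l]].

(* [jacobian] acts on row vectors from the right: its (j, i) entry is
   dF_i/dx_j, hence the transpose. *)
Definition DF F x : 'M[R]_(\sum_i n i) := (jacobian F x)^T.

End MultiHomogeneous.

(* Main.v *)
(* Let F(u) = lambda (x) u with u > 0 and F(x) = theta (x) x.  Take the least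
   alpha with x <= alpha (x) u; comparing F(x) with F(alpha (x) u) where x
   touches alpha (x) u in block i gives
     theta_i alpha_i <= (alpha^A)_i lambda_i,
   and alpha >= 1 by monotonicity of the norms.
   If rho(A) < 1 and x > 0, adding the logarithms of these inequalities and of
   those with u and x exchanged yields h <= A h with h >= 0, whence h = 0.
   If A^T b = r b with r <= 1, weighting the logarithms by b gives
   prod theta^b <= prod lambda^b.  When equality holds, all the inequalities
   above are equalities, so alpha^{-1} (x) x <= u is an eigenvector with the
   same eigenvalue lambda as u, touching u; irreducibility of DF(u) then forces
   it to be equal to u. *)
Require Import Defs.
From HB Require Import structures.
From mathcomp Require Import all_boot all_order all_algebra.
From mathcomp Require Import complex polyrcf ring lra.
From mathcomp Require Import all_classical all_reals all_analysis.

Set Implicit Arguments.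
Unset Strict Implicit.
Unset Printing Implicit Defensive.

Import Order.TTheory GRing.Theory Num.Theory.
Import numFieldNormedType.Exports.

Local Open Scope ring_scope.

(** * Nonnegative matrices with spectral radius below 1 *)

Section NonnegativeMatrices.
Variables (R : realType) (m : nat).
Implicit Types (M : 'M[R]_m) (h : 'cV[R]_m) (t : R).

(** A nonnegative real root is its own modulus. The [sup] is genuine because the sum of the moduli
    of all complex roots of the characteristic polynomial bounds the set. *)
Lemma root_char_poly_le_spectral_radius M t :
  root (char_poly M) t -> 0 <= t -> t <= spectral_radius M.
Proof.
move=> rt t0; apply: ub_le_sup; last first.
  exists (real_complex R t); last by rewrite /= expr0n addr0 sqrtr_sqr ger0_norm.
  by rewrite /= eigenvalue_map eigenvalue_root_char.
have [s def_p] := closed_field_poly_normal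
  (char_poly (map_mx (real_complex R) M)).
exists (\sum_(z <- s) ComplexField.Normc.normc z) => _ [z /= ez <-].
have zs : z \in s.
  move: ez; rewrite eigenvalue_root_char def_p rootZ ?root_prod_XsubC //.
  by rewrite (monicP (char_poly_monic _)) oner_eq0.
have normc_ge0 (w : R[i]) : 0 <= ComplexField.Normc.normc w.
  by case: w => a c; apply: sqrtr_ge0.
by rewrite (big_rem z) //= lerDl sumr_ge0.
Qed.

(** A monic polynomial is at least 1 far to the right, so a nonpositive value at [t] would yield a
    root beyond [t], hence above the spectral radius. *)
Lemma char_poly_gt0 M t : spectral_radius M < t -> 0 <= t ->
  0 < (char_poly M).[t].
Proof.
move=> rt t0; have [T PT] : exists T, forall x, T <= x -> 1 <= (char_poly M).[x].
  have := @poly_pinfty_gt_lc R (char_poly M).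
  by rewrite (monicP (char_poly_monic _)); apply.
rewrite ltNge; apply/negP => pt.
have [x /andP[tx _] rx] : exists2 x, t <= x <= Num.max t T & root (char_poly M) x.
  apply: poly_ivtW; first by rewrite le_max lexx.
  by rewrite pt (le_trans ler01) // PT // le_max lexx orbT.
have := root_char_poly_le_spectral_radius rx (le_trans t0 tx).
by rewrite leNgt (lt_le_trans rt tx).
Qed.

Lemma continuous_bigmin (I : Type) (s : seq I) (f : I -> R -> R) (c : R) :
  (forall i, continuous (f i)) ->
  continuous (fun x => \big[Num.min/c]_(i <- s) f i x).
Proof.
move=> cf x; elim: s => [|i s IHs].
  by under eq_fun do rewrite big_nil; apply: cvg_cst.
under eq_fun do rewrite big_cons.
by apply: continuous_min; [apply: cf | apply: IHs].
Qed.

(* y = adj(1 - M) 1.  The entries q_i of adj(t - M) 1 are polynomials in t with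
   t q_i = sum_k M_ik q_k + p(t), where p > 0 on [1, +oo[ is the characteristic
   polynomial.  So for t >= 1 min_i q_i(t) cannot vanish; it is positive for
   large t, hence on all of [1, +oo[. *)
Lemma exists_strict_subinvariant M : mx_nonneg M -> spectral_radius M < 1 ->
  exists y : 'cV[R]_m, mx_pos y /\ forall i, (M *m y) i 0 < y i 0.
Proof.
move=> M0 rM.
pose q i := \sum_j (\adj (char_poly_mx M)) i j.
have qE t i : t * (q i).[t] = \sum_k M i k * (q k).[t] + (char_poly M).[t].
  have qcol : \adj (char_poly_mx M) *m const_mx 1 = \col_k q k.
    apply/colP => k; rewrite !mxE; apply: eq_bigr => j _.
    by rewrite !mxE mulr1.
  have: (char_poly_mx M *m \col_k q k) i 0 = char_poly M.
    by rewrite -qcol mulmxA mul_mx_adj mul_scalar_mx !mxE mulr1.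
  rewrite mulmxBl mul_scalar_mx !mxE => <-.
  clearbody q; rewrite hornerD hornerN hornerM hornerX horner_sum.
  rewrite [X in _ - X](eq_bigr (fun k => M i k * (q k).[t])).
    by rewrite addrC subrK.
  by move=> k _; rewrite !mxE hornerM hornerC.
have p_gt0 t : 1 <= t -> 0 < (char_poly M).[t].
  by move=> t1; apply: char_poly_gt0; [apply: lt_le_trans t1 | lra].
have q_gt0 t : 1 <= t -> (forall i, 0 <= (q i).[t]) -> forall i, 0 < (q i).[t].
  move=> t1 q0 i; have t0 : 0 < t by lra.
  rewrite -(pmulr_rgt0 _ t0) qE ltr_wpDl ?p_gt0 //.
  by apply: sumr_ge0 => k _; rewrite mulr_ge0.
pose T := 1 + \sum_i \sum_k M i k.
have rowT i : \sum_k M i k < T.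
  rewrite (@le_lt_trans _ _ (\sum_i \sum_k M i k)) ?ltrDr // [leRHS](bigD1 i) //=.
  rewrite lerDl.
  by apply: sumr_ge0 => j _; apply: sumr_ge0.
have T1 : 1 <= T.
  by rewrite lerDl; apply: sumr_ge0 => j _; apply: sumr_ge0.
(* [T] exceeds every row sum: at an index j minimizing q_j(T), (T - sum_k M_jk) q_j = sum_k M_jk
   (q_k - q_j) + p(T) >= 0. *)
have qT i : 0 < (q i).[T].
  apply: q_gt0 => // {}i.
  case: (arg_minP (fun i => (q i).[T]) (erefl : predT i)) => j _ jmin.
  apply: le_trans (jmin i isT); rewrite -(pmulr_rge0 _ (_ : 0 < T - \sum_k M j k)).
    rewrite mulrBl qE mulr_suml addrAC -sumrB.
    apply: addr_ge0; last exact/ltW/p_gt0.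
    by apply: sumr_ge0 => k _; rewrite -mulrBr mulr_ge0 // subr_ge0 jmin.
  by rewrite subr_gt0.
(* The default 1 is positive, so the sign of [f t] tells whether all the entries are positive. *)
pose f t := \big[Num.min/1]_(i < m) (q i).[t].
have f_gt0 t : 1 <= t -> 0 <= f t -> 0 < f t.
  move=> t1 /bigmin_geP[_ ft]; apply/bigmin_gtP; split=> // i _.
  by apply: q_gt0 => // j; apply: ft.
have fT : 0 < f T by apply/bigmin_gtP; split=> // i _.
have f1 : 0 < f 1.
  rewrite ltNge; apply/negP => f1.
  have [|||t] := @IVT R f 1 T 0 => //.
  - apply: continuous_subspaceT; apply: continuous_bigmin => i.
    exact: continuous_horner.
  - by rewrite ge_min f1 /= le_max (ltW fT) orbT.
  rewrite in_itv /= => /andP[t1 _] ft; have := f_gt0 t t1.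
  by rewrite ft ltxx lexx => /(_ isT).
have q1 i : 0 < (q i).[1] by have /bigmin_gtP[_ ->] := f1.
exists (\col_i (q i).[1]); split=> [i j|i]; first by rewrite mxE.
rewrite !mxE -[ltRHS]mul1r qE (eq_bigr (fun k => M i k * (q k).[1])).
  by rewrite ltrDl p_gt0.
by move=> k _; rewrite mxE.
Qed.

(** Let M y < y with y > 0, and let c = max h_k / y_k be attained at i. If c > 0, then c y_i = h_i
    <= (M h)_i <= c (M y)_i < c y_i, which is absurd. *)
Lemma subinvariant_le0 M h : mx_nonneg M -> spectral_radius M < 1 ->
  (forall i, h i 0 <= (M *m h) i 0) -> forall i, h i 0 <= 0.
Proof.
move=> M0 rM hM i0; have [y [y0 yM]] := exists_strict_subinvariant M0 rM.
have [i _ imax] := arg_maxP (fun i => h i 0 / y i 0) (erefl : predT i0).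
set c := h i 0 / y i 0 in imax.
have hc k : h k 0 <= c * y k 0 by rewrite -ler_pdivrMr; [apply: imax | apply: y0].
have hi : h i 0 = c * y i 0 by rewrite divfK // gt_eqF.
have : c * y i 0 <= c * (M *m y) i 0.
  rewrite -hi (le_trans (hM i)) // !mxE mulr_sumr; apply: ler_sum => k _.
  by rewrite mulrCA ler_wpM2l.
have [c0 _|c0] := leP c 0; last by rewrite ler_pM2l // leNgt yM.
by apply: (le_trans (hc i0)); rewrite mulr_le0_ge0 // ltW.
Qed.

End NonnegativeMatrices.

(** The partial derivative is already the limit of the left difference quotients, which vanish. The
    left side suits comparison with a vector lying below [x]. *)
Lemma jacobian_eq0_of_left_constant (R : realType) (m p : nat)
    (f : 'rV[R]_m -> 'rV[R]_p) (x : 'rV[R]_m) (l : 'I_m) (k : 'I_p) :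
  differentiable f x ->
  (\forall t \near (0^'-)%classic, f (t *: delta_mx 0 l + x) 0 k = f x 0 k) ->
  jacobian f x l k = 0.
Proof.
move=> df fx; have -> : jacobian f x l k = ('D_(delta_mx 0 l) f x) 0 k.
  by rewrite deriveEjacobian // -rowE [RHS]mxE.
have /cvg_dnbhs_at_left D_cvg := @diff_derivable _ _ _ f x 'e_l df.
have Dk_cvg := cvg_comp _ _ D_cvg (@coord_continuous R 1 p 0 k _).
rewrite -(cvg_lim _ Dk_cvg) //; apply: lim_near_cst => //.
by apply: filterS fx => t fxt; rewrite /= !mxE fxt subrr mulr0.
Qed.

(** * Blocks, multiplicative powers and their logarithms *)

Section MultiHomogeneous.
Variables (R : realType) (d : nat) (n : 'I_d -> nat).
Implicit Types (x y u : multivec R n) (a l b : 'cV[R]_d) (A : 'M[R]_d).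
Implicit Type F : multivec R n -> multivec R n.
Implicit Type g : forall i, 'rV[R]_(n i) -> R.

Local Notation block k := (@tagnat.sig1 d n k).
Local Notation lnv a := (map_mx (@ln R) a).

Lemma otimesE a x k : otimes a x 0 k = a (block k) 0 * x 0 k.
Proof. by rewrite !mxE tagnat.sig2K. Qed.

Lemma submxrow_otimes a x i : submxrow (otimes a x) i = a i 0 *: submxrow x i.
Proof. exact: mxrowK. Qed.

Lemma leKE x y : leK x y <-> forall k, x 0 k <= y 0 k.
Proof.
split=> [xy k|xy i k]; first by have := xy 0 k; rewrite !mxE subr_ge0.
by rewrite (ord1 i) !mxE subr_ge0.
Qed.

Lemma mpow_gt0 a A : mx_pos a -> mx_pos (mpow a A).
Proof.
by move=> a0 i j; rewrite mxE; apply: prodr_gt0 => k _; apply: powR_gt0.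
Qed.

Lemma ln_mpow a A : mx_pos a -> lnv (mpow a A) = A *m lnv a.
Proof.
move=> a0; apply/colP => i; rewrite !mxE.
rewrite (eq_bigr (fun k => expR (A i k * ln (a k 0)))).
  by rewrite -expR_sum expRK; apply: eq_bigr => k _; rewrite mxE.
by move=> k _; rewrite /powR gt_eqF.
Qed.

Lemma mpow_inv a A i : mx_pos a ->
  mpow (map_mx GRing.inv a) A i 0 = (mpow a A i 0)^-1.
Proof.
move=> a0; rewrite !mxE -prodfV; apply: eq_bigr => k _.
by rewrite mxE -powRN /powR !gt_eqF ?invr_gt0 // lnV ?posrE // mulrN mulNr.
Qed.

Lemma wprodE b l : mx_pos l -> wprod b l = expR (\sum_i b i 0 * ln (l i 0)).
Proof.
by move=> l0; rewrite expR_sum; apply: eq_bigr => i _; rewrite /powR gt_eqF.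
Qed.

Lemma wprod_eq0 b l i : mx_pos b -> l i 0 = 0 -> wprod b l = 0.
Proof.
by move=> b0 li0; rewrite /wprod (bigD1 i) //= li0 powR0 ?mul0r // gt_eqF.
Qed.

(* a i = max_j x_ij / u_ij *)
Definition touching a x u : Prop :=
  (forall k, x 0 k <= otimes a u 0 k) /\
  (forall i, exists2 k, block k = i & x 0 k = otimes a u 0 k).

(** * Least blockwise scalings dominating a given vector *)

Section Touching.
Hypothesis n_gt0 : forall i, (0 < n i)%N.

Lemma exists_touching x u : Kpplus u -> exists a, touching a x u.
Proof.
move=> u0.
have ex_i (i : 'I_d) : exists c : R,
    (forall k, block k = i -> x 0 k <= c * u 0 k) /\
    (exists2 k, block k = i & x 0 k = c * u 0 k).
  (* Block [i] is nonempty, so the maximum of the ratios over it is attained. *)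
  have Pi : [pred k | block k == i] (tagnat.Rank i (Ordinal (n_gt0 i))).
    by rewrite /= tagnat.Rank1K.
  have [k /eqP ki kmax] := arg_maxP (fun k => x 0 k / u 0 k) Pi.
  exists (x 0 k / u 0 k); split=> [k' /eqP k'i|].
    by rewrite -ler_pdivrMr; [apply: kmax | apply: u0].
  by exists k => //; rewrite divfK // gt_eqF.
have [c cP] := fin_all_exists ex_i.
exists (\col_i c i); split=> [k|i].
  by rewrite otimesE mxE (cP _).1.
by have [_ [k ki xk]] := cP i; exists k => //; rewrite otimesE mxE ki.
Qed.

Lemma eigenvalue_gt0 F A x l : in_Hd F A -> Kpplus x -> F x = otimes l x ->
  mx_pos l.
Proof.
move=> [_ _ _ _ [Fpos _]] x0 Fx i j; rewrite (ord1 j).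
have := Fpos x x0 0 (tagnat.Rank i (Ordinal (n_gt0 i))).
by rewrite Fx otimesE tagnat.Rank1K pmulr_lgt0.
Qed.

End Touching.

(** In each block, monotonicity gives 1 = N(x_i) <= N(a_i u_i) = a_i. *)
Lemma touching_ge1 g a x u : (forall i, monotonic_norm (@g i)) ->
  Splus g x -> Spplus g u -> touching a x u -> forall i, 1 <= a i 0.
Proof.
move=> gN [x0 gx] [[_ gu] u0] [xa eqa] i.
have [k ki xk] := eqa i.
have ai0 : 0 <= a i 0.
  by rewrite -(pmulr_lge0 _ (u0 0 k)) -ki -otimesE -xk.
have [_ gZ _ gmono] := gN i.
have <- : g i (a i 0 *: submxrow u i) = a i 0 by rewrite gZ gu mulr1 ger0_norm.
rewrite -(gx i).
apply: gmono => j; rewrite -submxrow_otimes ![submxrow _ _ _ _]mxE ger0_norm //.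
exact: le_trans (xa _) (ler_norm _).
Qed.

Lemma Splus_otimes_eq g a x u : (forall i, monotonic_norm (@g i)) ->
  Splus g x -> Splus g u -> mx_nonneg a -> x = otimes a u -> x = u.
Proof.
move=> gN [_ gx] [_ gu] a0 xE; apply/rowP => k; rewrite xE otimesE.
have [_ gZ _ _] := gN (block k).
have := gx (block k); rewrite xE submxrow_otimes gZ gu mulr1 ger0_norm //.
by move=> ->; rewrite mul1r.
Qed.

Lemma Kplus_otimes a x : mx_nonneg a -> Kplus x -> Kplus (otimes a x).
Proof. by move=> a0 x0 i k; rewrite (ord1 i) otimesE mulr_ge0. Qed.

Lemma mx_pos_nonneg p q (M : 'M[R]_(p, q)) : mx_pos M -> mx_nonneg M.
Proof. by move=> M0 i j; apply: ltW. Qed.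

(* Evaluate F x <= F (a (x) u) at a coordinate of each block where x and
   a (x) u agree. *)
Lemma touching_eigenvalue_le F A a x u l t : in_Hd F A ->
  Kplus x -> Kpplus u -> F u = otimes l u -> F x = otimes t x ->
  mx_nonneg a -> touching a x u ->
  forall i, t i 0 * a i 0 <= mpow a A i 0 * l i 0.
Proof.
move=> [_ _ [_ Fhom] Fmono _] x0 u0 Fu Fx a0 [xa eqa] i.
have u0' := mx_pos_nonneg u0; have [k ki xk] := eqa i.
have /leKE/(_ k) : leK (F x) (F (otimes a u)).
  by apply: Fmono => //; [apply: Kplus_otimes | apply/leKE].
rewrite Fx Fhom // Fu !otimesE xk otimesE ki !mulrA.
by rewrite ler_pM2r.
Qed.

Lemma touching_ln_le F A a x u l t : in_Hd F A ->
  Kplus x -> Kpplus u -> F u = otimes l u -> F x = otimes t x ->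
  mx_pos a -> mx_pos l -> mx_pos t -> touching a x u ->
  forall i, ln (t i 0) + ln (a i 0) <= (A *m lnv a) i 0 + ln (l i 0).
Proof.
move=> FA x0 u0 Fu Fx a0 l0 t0 xau i; rewrite -ln_mpow // mxE.
rewrite -!lnM ?posrE ?mpow_gt0 // ler_ln ?posrE ?mulr_gt0 ?mpow_gt0 //.
exact: (touching_eigenvalue_le FA x0 u0 Fu Fx (mx_pos_nonneg a0) xau).
Qed.

(** The weighted slacks [D i] are nonnegative and sum to ln(l^b) - ln(t^b) + (r - 1) sum_i b_i ln
    a_i, whose last term is nonpositive. If l^b <= t^b, the sum is 0 and so is every slack. *)
Lemma wprod_le_of_ln_le A a b l t r : mx_pos b -> A^T *m b = r *: b -> r <= 1 ->
  (forall i, 1 <= a i 0) -> mx_pos l -> mx_pos t ->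
  (forall i, ln (t i 0) + ln (a i 0) <= (A *m lnv a) i 0 + ln (l i 0)) ->
  wprod b t <= wprod b l /\
  (wprod b l <= wprod b t ->
   forall i, ln (t i 0) + ln (a i 0) = (A *m lnv a) i 0 + ln (l i 0)).
Proof.
move=> b0 Ab r1 a1 l0 t0 ineq; rewrite !wprodE // !ler_expR.
pose D i := b i 0 * ((A *m lnv a) i 0 + ln (l i 0) - (ln (t i 0) + ln (a i 0))).
have D0 i : 0 <= D i by rewrite mulr_ge0 ?subr_ge0 // ltW.
have sumA : \sum_i b i 0 * (A *m lnv a) i 0 = r * \sum_i b i 0 * ln (a i 0).
  have: (b^T *m (A *m lnv a)) 0 0 = ((A^T *m b)^T *m lnv a) 0 0.
    by rewrite trmx_mul trmxK mulmxA.
  rewrite Ab linearZ -scalemxAl !mxE.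
  under eq_bigr do rewrite mxE.
  by move=> ->; congr (_ * _); apply: eq_bigr => i _; rewrite !mxE.
have sumD : \sum_i D i = \sum_i b i 0 * ln (l i 0) - \sum_i b i 0 * ln (t i 0)
    + (r - 1) * \sum_i b i 0 * ln (a i 0).
  rewrite mulrBl mul1r -sumA -!sumrB -big_split /=.
  by apply: eq_bigr => i _; rewrite /D; ring.
have a0 : 0 <= \sum_i b i 0 * ln (a i 0).
  by apply: sumr_ge0 => i _; rewrite mulr_ge0 ?ln_ge0 // ltW.
have ra : (r - 1) * \sum_i b i 0 * ln (a i 0) <= 0.
  by rewrite mulr_le0_ge0 // subr_le0.
have D0' : 0 <= \sum_i D i by apply: sumr_ge0.
split=> [|lt i]; first by lra.
have /(_ (fun i _ => D0 i)) := @psumr_eq0P R _ predT D.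
have -> : \sum_i D i = 0 by lra.
move=> /(_ erefl i isT)/eqP; rewrite mulf_eq0 gt_eqF //= subr_eq0.
by move=> /eqP.
Qed.

(* If w differs from u, let S be the set of coordinates where they agree.  For
   l outside S and k in S, F_k is constant on [u - e e_l, u] for small e, being
   squeezed between F_k(w) = F_k(u) and F_k(u); so DF(u)_kl = 0. *)
Lemma eigenvector_below_eq F A u w l : in_Hd F A -> Kpplus u -> Kplus w ->
  F u = otimes l u -> F w = otimes l w -> leK w u ->
  (exists k, w 0 k = u 0 k) -> differentiable F u -> irreducible_mx (DF F u) ->
  w = u.
Proof.
move=> [_ _ _ Fmono _] u0 w0 Fu Fw wu [k0 wk0] dF irr.
have u0' := mx_pos_nonneg u0; move/leKE: (wu) => wu'.
apply: contrapT => neq_wu; apply: irr.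
exists [set k | w 0 k == u 0 k]%SET; split.
- by apply/set0Pn; exists k0; rewrite inE wk0.
- apply/negP => /eqP S_T; apply: neq_wu; apply/rowP => k.
  by have := finset.in_setT k; rewrite -S_T inE => /eqP.
move=> k j; rewrite !inE => /eqP wk wj; rewrite mxE.
apply: jacobian_eq0_of_left_constant => //.
have wuj : w 0 j < u 0 j by rewrite lt_neqAle wj wu'.
(* For w_j - u_j < t < 0 the point u + t e_j stays between [w] and [u]. *)
near=> t; have t0 : t < 0 by near: t; apply: nbhs_left_lt.
have tw : w 0 j - u 0 j < t.
  by near: t; apply: nbhs_left_gt; rewrite subr_lt0.
have tE i : (t *: delta_mx 0 j + u) 0 i = t *+ (i == j) + u 0 i.
  by rewrite !mxE eqxx /= mulr_natr.
have wt : leK w (t *: delta_mx 0 j + u).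
  apply/leKE => i; rewrite tE; have [->|_] := eqVneq i j.
    by rewrite mulr1n -lerBlDr ltW.
  by rewrite mulr0n add0r.
have tu : leK (t *: delta_mx 0 j + u) u.
  apply/leKE => i; rewrite tE gerDr; case: (_ == _) => //.
  by rewrite mulr1n ltW.
have t_ge0 : Kplus (t *: delta_mx 0 j + u).
  by move=> i s; rewrite (ord1 i); move/leKE: wt => /(_ s); apply: le_trans.
apply/eqP; rewrite eq_le.
move/leKE: (Fmono _ _ t_ge0 u0' tu) => -> /=.
move/leKE: (Fmono _ _ w0 t_ge0 wt) => /(_ k); apply: le_trans.
by rewrite Fw Fu !otimesE wk.
Unshelve. all: by end_near.
Qed.

(** Rescaling [x] by the inverse of [a] turns the eigenvalue [t] into exactly [l] and gives a vector
    below [u] that touches it, so [eigenvector_below_eq] applies. *)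
Lemma touching_eigenvector_eq F A a x u l t : (0 < d)%N -> in_Hd F A ->
  Kplus x -> Kpplus u -> F u = otimes l u -> F x = otimes t x ->
  mx_pos a -> touching a x u ->
  (forall i, t i 0 * a i 0 = mpow a A i 0 * l i 0) ->
  differentiable F u -> irreducible_mx (DF F u) ->
  x = otimes a u.
Proof.
move=> d0 FA x0 u0 Fu Fx a0 [xa eqa] ta dF irr.
pose c := map_mx GRing.inv a.
have cE i : c i 0 = (a i 0)^-1 by rewrite mxE.
have c0 : mx_nonneg c by move=> i j; rewrite mxE invr_ge0 ltW.
suff xu : otimes c x = u.
  by apply/rowP => k; rewrite -xu !otimesE cE mulVKf // gt_eqF.
apply: (eigenvector_below_eq FA u0 _ Fu) => //.
- exact: Kplus_otimes.
- have [_ _ [_ Fhom] _ _] := FA.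
  rewrite Fhom // Fx; apply/rowP => k; rewrite !otimesE mpow_inv // cE.
  have p0 := mpow_gt0 A a0 (block k) 0.
  have -> : t (block k) 0 = mpow a A (block k) 0 * l (block k) 0 / a (block k) 0.
    by rewrite -ta mulfK // gt_eqF.
  by field; rewrite !gt_eqF.
- apply/leKE => k; rewrite otimesE cE mulrC ler_pdivrMr // mulrC.
  by rewrite -otimesE.
- have [k _ xk] := eqa (Ordinal d0); exists k.
  by rewrite otimesE xk otimesE cE mulKf // gt_eqF.
Qed.

(** * Comparison of any normalized eigenvector with a positive one *)

Section Comparison.
Variables (F : multivec R n -> multivec R n) (A : 'M[R]_d).
Variables (g : forall i, 'rV[R]_(n i) -> R) (b l t : 'cV[R]_d) (r : R).
Variables (u x : multivec R n).
Hypotheses (d_gt0 : (0 < d)%N) (n_gt0 : forall i, (0 < n i)%N).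
Hypotheses (gN : forall i, monotonic_norm (@g i)) (FA : in_Hd F A).
Hypotheses (b0 : mx_pos b) (Ab : A^T *m b = r *: b) (r1 : r <= 1).
Hypotheses (uS : Spplus g u) (Fu : F u = otimes l u).
Hypotheses (xS : Splus g x) (t0 : mx_nonneg t) (Fx : F x = otimes t x).

Let l0 : mx_pos l := eigenvalue_gt0 n_gt0 FA uS.2 Fu.

Lemma wprod_eigenvalue_le : wprod b t <= wprod b l.
Proof.
have [t_gt0|/existsNP[i /negP ti]] := pselect (forall i, 0 < t i 0); last first.
  rewrite (@wprod_eq0 b t i) ?wprodE ?expR_ge0 //.
  by apply: le_anti; rewrite t0 leNgt ti.
have [a xau] := exists_touching n_gt0 x uS.2.
have a1 := touching_ge1 gN xS uS xau.
have a0 : mx_pos a by move=> i j; rewrite (ord1 j) (lt_le_trans ltr01).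
have t0' : mx_pos t by move=> i j; rewrite (ord1 j).
have ineq := touching_ln_le FA xS.1 uS.2 Fu Fx a0 l0 t0' xau.
by have [] := wprod_le_of_ln_le b0 Ab r1 a1 l0 t0' ineq.
Qed.

Lemma eigenvector_eq_of_wprod_ge : wprod b l <= wprod b t ->
  differentiable F u -> irreducible_mx (DF F u) -> x = u.
Proof.
move=> lt dF irr.
have t_gt0 : mx_pos t.
  move=> i j; rewrite (ord1 j) lt_neqAle t0 andbT; apply/eqP => ti.
  by move: lt; rewrite (wprod_eq0 b0 (esym ti)) wprodE // leNgt expR_gt0.
have [a xau] := exists_touching n_gt0 x uS.2.
have a1 := touching_ge1 gN xS uS xau.
have a0 : mx_pos a by move=> i j; rewrite (ord1 j) (lt_le_trans ltr01).
have ineq := touching_ln_le FA xS.1 uS.2 Fu Fx a0 l0 t_gt0 xau.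
have [_ /(_ lt) ln_eq] := wprod_le_of_ln_le b0 Ab r1 a1 l0 t_gt0 ineq.
apply: (Splus_otimes_eq gN xS uS.1 (mx_pos_nonneg a0)).
apply: (touching_eigenvector_eq d_gt0 FA xS.1 uS.2 Fu Fx) => // i.
apply: ln_inj; rewrite ?posrE ?mulr_gt0 ?mpow_gt0 //.
rewrite !lnM ?posrE ?mpow_gt0 // ln_eq -ln_mpow // mxE //.
Qed.

End Comparison.

(* With a = max x/u and c = max u/x, the vector h = ln a + ln c satisfies
   0 <= h <= A h. *)
Lemma positive_eigenvector_unique g F A u x :
  (forall i, (0 < n i)%N) -> (forall i, monotonic_norm (@g i)) -> in_Hd F A ->
  spectral_radius A < 1 -> Spplus g u -> eigenvector F u ->
  Spplus g x -> eigenvector F x -> x = u.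
Proof.
move=> n_gt0 gN FA rA uS [_ _ [l [_ Fu]]] xS [_ _ [t [_ Fx]]].
have l0 := eigenvalue_gt0 n_gt0 FA uS.2 Fu.
have t0 := eigenvalue_gt0 n_gt0 FA xS.2 Fx.
have [a xau] := exists_touching n_gt0 x uS.2.
have [c ucx] := exists_touching n_gt0 u xS.2.
have a1 := touching_ge1 gN xS.1 uS xau; have c1 := touching_ge1 gN uS.1 xS ucx.
have a0 : mx_pos a by move=> i j; rewrite (ord1 j) (lt_le_trans ltr01).
have c0 : mx_pos c by move=> i j; rewrite (ord1 j) (lt_le_trans ltr01).
have A0 : mx_nonneg A by case: FA => _ _ [].
have h0 := @subinvariant_le0 _ _ A (lnv a + lnv c) A0 rA.
have {}h0 i : ln (a i 0) + ln (c i 0) <= 0.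
  have := h0 _ i; rewrite !mxE; apply=> {}i; rewrite mulmxDr !mxE.
  have := touching_ln_le FA xS.1.1 uS.2 Fu Fx a0 l0 t0 xau i.
  have := touching_ln_le FA uS.1.1 xS.2 Fx Fu c0 t0 l0 ucx i.
  rewrite !mxE; lra.
have eq1 i : a i 0 = 1 /\ c i 0 = 1.
  have ha := ln_ge0 (a1 i); have hc := ln_ge0 (c1 i); have hi := h0 i.
  by split; apply/eqP; rewrite -ln_eq0 //; apply/eqP; lra.
apply/rowP => k; apply: le_anti.
have := xau.1 k; have := ucx.1 k; rewrite !otimesE.
by have [-> ->] := eq1 (block k); rewrite !mul1r => -> ->.
Qed.

End MultiHomogeneous.

Theorem theorem6p2 (R : realType) (d : nat) (n : 'I_d -> nat)
    (hd : (0 < d)%N) (hn : forall i, (0 < n i)%N)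
    (g : forall i, 'rV[R]_(n i) -> R) (hg : forall i, monotonic_norm (g i))
    (F : multivec R n -> multivec R n) (A : 'M[R]_d) (hF : in_Hd F A)
    (b : 'cV[R]_d) (hb : mx_pos b) (hb1 : \sum_i b i 0 = 1)
    (u : multivec R n) (huS : Spplus g u) (hu : eigenvector F u) :
  (spectral_radius A < 1 \/
     [/\ A^T *m b = b, differentiable F u & irreducible_mx (DF F u)] ->
   forall w, Spplus g w -> eigenvector F w -> w = u) /\
  (forall (v : multivec R n) (theta : 'cV[R]_d),
     Splus g v -> ~ Spplus g v -> eigenvector F v ->
     mx_nonneg theta -> F v = otimes theta v ->
     spectral_radius A <= 1 ->
     A^T *m b = spectral_radius A *: b ->
     differentiable F u -> irreducible_mx (DF F u) ->
     wprod b theta < rspec g b F).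
Proof.
split=> [[rA w wS hw|[Ab dF irr] w wS [_ _ [t [t0 Fw]]]]|].
- exact: positive_eigenvector_unique rA huS hu wS hw.
- have [_ _ [l [l0 Fu]]] := hu; rewrite -[b in RHS]scale1r in Ab.
  apply: (eigenvector_eq_of_wprod_ge hd hn hg hF hb Ab _ huS Fu wS.1 t0 Fw) => //.
  (* Since [w] is positive too, the comparison holds with the roles of [u] and [w] exchanged. *)
  exact: (wprod_eigenvalue_le hn hg hF hb Ab _ wS Fw huS.1 l0 Fu).
move=> v theta vS vNS _ theta0 Fv r1 Ab dF irr.
have [_ _ [l [l0 Fu]]] := hu.
rewrite ltNge; apply/negP => le_theta; apply: vNS.
suff -> : v = u by [].
apply: (eigenvector_eq_of_wprod_ge hd hn hg hF hb Ab r1 huS Fu) => //.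
(* The value at [u] belongs to the set defining [rspec], and the comparison shows that it also
   bounds that set. *)
apply: le_trans le_theta; apply: ub_le_sup; last first.
  by exists u, l; split=> //; apply: huS.1.
exists (wprod b l) => _ [x [t [xS t0 Fx ->]]].
exact: (wprod_eigenvalue_le hn hg hF hb Ab r1 huS Fu xS t0 Fx).
Qed.
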